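(* Let $G$ be a finite soluble group. Then $m(G)\le \delta(G)$.
   Context: For a finite group $G$, a generating set $X$ of $G$ is called minimal (or independent) if no proper subset of $X$ generates $G$; $m(G)$ denotes the largest size of a minimal generating set of $G$. $\pi(G)$ denotes the set of prime divisors of $|G|$. For a prime $p$, $d_p(G)$ denotes the minimal number of generators of a Sylow $p$-subgroup of $G$. One sets $\delta(G):=\sum_{p\in\pi(G)}d_p(G)$. *)

(* Defs.v *)
From mathcomp Require Import all_boot all_fingroup all_solvable.

Set Implicit Arguments.
Unset Strict Implicit.
Unset Printing Implicit Defensive.

Local Open Scope group_scope.

Section GeneratorNumbers.

Variable gT : finGroupType.
Implicit Types (G P : {group gT}) (X Y : {set gT}) (p : nat).

Definition minimal_generating G X : bool := minset (fun Y => <<Y>> == G) X.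

Lemma minimal_generatingP G X :
  reflect (<<X>> = G /\ forall Y, Y \proper X -> <<Y>> <> G)
          (minimal_generating G X).
Proof.
apply: (iffP minsetP) => [[/eqP genX minX] | [genX minX]].
  split=> // Y /properP[sYX [x Xx nYx]] genY.
  by rewrite (minX Y) ?Xx ?genY in nYx.
split=> [|Y /eqP genY sYX]; first exact/eqP.
apply/eqP; apply: contraT => neqYX.
by case: (minX Y) => //; rewrite properEneq neqYX.
Qed.

(* This is the largest size m(G) of a minimal generating set; MathComp's
   'm(G) is the smallest size of a generating set. *)
Definition max_grank G : nat :=
  \max_(X : {set gT} | minimal_generating G X) #|X|.

(* The chosen Sylow subgroup is immaterial, see sylow_grankE. *)
Definition sylow_grank p G : nat := 'm(sval (Sylow_exists p G)).

Lemma sylow_grankE p G P : p.-Sylow(G) P -> sylow_grank p G = 'm(P).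
Proof.
rewrite /sylow_grank; case: (Sylow_exists p G) => Q sylQ /= sylP.
have [x _ ->] := Sylow_trans sylP sylQ.
by rewrite -(isog_grank (conj_isog P x)).
Qed.

Definition delta G : nat := \sum_(p <- primes #|G|) sylow_grank p G.

End GeneratorNumbers.

(* Main.v *)
(**
Induct on the order of G, passing to G / N for a minimal normal subgroup N of
the soluble group G; thus N is an elementary abelian p-group.  Let X be a
minimal generating set of G, and choose Y in X minimal subject to <Y>N = G.
The image of Y is a minimal generating set of G / N of the same size.  Either
<Y> = G, so that X = Y, or <Y> is a complement of N; in the latter case <Y> is
a maximal subgroup, so one further element of X suffices.  Hence
m(G) <= m(G/N) + 1, with m(G) <= m(G/N) unless N is complemented.  On the other
hand, if N is complemented, then N is not inside the Frattini subgroup of a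
Sylow p-subgroup P, so by the Burnside basis theorem d(P/N) < d(P).
*)
Require Import Defs.
From mathcomp Require Import all_boot all_fingroup all_solvable.

Set Implicit Arguments.
Unset Strict Implicit.
Unset Printing Implicit Defensive.

Local Open Scope group_scope.

Section Quotients.

Variable gT : finGroupType.
Implicit Types (G H N P : {group gT}) (X Y : {set gT}) (p : nat).

Lemma gen_quotient_eq G N Y :
  N <| G -> Y \subset G -> (<<Y / N>> == G / N) = (N <*> Y == G).
Proof.
move=> nsNG sYG; have [sNG nNG] := andP nsNG.
rewrite -quotient_gen ?(subset_trans sYG) // -(@quotientYidl _ N <<Y>>%G).
  rewrite joing_idr; apply/eqP/eqP=> [|-> //].
  apply: quotient_inj => //; apply/andP; rewrite joing_subl.
  by split=> //; rewrite join_subG normG (subset_trans sYG).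
by rewrite gen_subG (subset_trans sYG).
Qed.

(** Picking one preimage in [Y] for each element of [B] suffices. The bound on [#|Z|] carries sizes
    of generating sets back from the quotient. *)
Lemma quotient_subset_lift N Y (B : {set coset_of N}) :
    Y \subset 'N(N) -> B \subset Y / N ->
  exists Z : {set gT}, [/\ Z \subset Y, Z / N = B & #|Z| <= #|B|].
Proof.
move=> nNY sBY; pose g b := odflt 1 [pick y in Y | coset N y == b].
have gP b : b \in B -> g b \in Y /\ coset N (g b) = b.
  move=> Bb; rewrite /g; case: pickP => [y /andP[Yy /eqP] // | noY].
  have /morphimP[y _ Yy def_b] := subsetP sBY b Bb.
  by have:= noY y; rewrite /= Yy def_b eqxx.
have sZY: g @: B \subset Y by apply/subsetP=> _ /imsetP[b /gP[]] + + ->.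
exists (g @: B); split; rewrite ?leq_imset_card //.
rewrite quotientE morphimEsub ?(subset_trans sZY) // -imset_comp.
by rewrite -[RHS]imset_id; apply: eq_in_imset => b /gP[].
Qed.

(** Burnside basis theorem: [P / 'Phi(P)] is elementary abelian, so its rank is its dimension, and
    lifted generators generate [P] since elements of ['Phi(P)] are non-generators. *)
Lemma grank_pgroup p P : p.-group P -> 'm(P) = logn p #|P : 'Phi(P)|.
Proof.
move=> pP; have nsPhi := Phi_normal P; have nPhi := normal_norm nsPhi.
have abP := Phi_quotient_abelem pP.
have <-: 'm(P / 'Phi(P)) = logn p #|P : 'Phi(P)|.
  by rewrite grank_abelian ?(abelem_abelian abP) // (rank_abelem abP) card_quotient.
apply/eqP; rewrite eqn_leq quotient_grank // andbT.
have [B genB <-] := grank_witness (P / 'Phi(P)).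
have [|Y [sYP YB leYB]] := quotient_subset_lift nPhi (B := B).
  by rewrite -genB subset_gen.
move: genB => /eqP; rewrite -YB (gen_quotient_eq nsPhi) // => /eqP/Phi_nongen genY.
by rewrite YB; apply: leq_trans leYB; rewrite -{1}genY grank_min.
Qed.

End Quotients.

Lemma grank_pgroup_quotient_lt (gT : finGroupType) (p : nat) (P N : {group gT}) :
  p.-group P -> N <| P -> ~~ (N \subset 'Phi(P)) -> 'm(P / N) < 'm(P).
Proof.
move=> pP /andP[sNP nNP] not_sNPhi.
rewrite (grank_pgroup (quotient_pgroup N pP)) (grank_pgroup pP).
have sKP : N <*> 'Phi(P) \subset P by rewrite join_subG sNP Phi_sub.
(* For a p-group the Frattini subgroup of [P / N] is the image of ['Phi(P)], so both ranks become
   logarithms of indices in [P], of [N <*> 'Phi(P)] and of ['Phi(P)]. *)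
rewrite -(quotient_Phi pP nNP) -(quotientYidl (subset_trans (Phi_sub P) nNP)).
rewrite index_quotient_eq ?(subset_trans (subsetIr _ _) (joing_subl _ _)) //.
have sPhiK : 'Phi(P) \subset N <*> 'Phi(P) := joing_subr _ _.
rewrite -(Lagrange_index sKP sPhiK) lognM // -addn1 leq_add2l lt0n.
apply: contraNneq not_sNPhi => log0.
apply: subset_trans (joing_subl N 'Phi(P)) _; rewrite -indexg_eq1.
have pK : p.-nat #|N <*> 'Phi(P) : 'Phi(P)|.
  exact: pnat_dvd (dvdn_indexg _ _) (pgroupS sKP pP).
by rewrite -(part_pnat_id pK) p_part log0.
Qed.

Section MinimalGeneratingSets.

Variable gT : finGroupType.
Implicit Types (G H N P : {group gT}) (X Y : {set gT}) (p : nat).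

Lemma minimal_generating_sub G X Y :
  minimal_generating G X -> Y \subset X -> <<Y>> = G -> Y = X.
Proof. by move=> /minsetP[_ minX] sYX genY; apply: minX; rewrite ?genY. Qed.

Lemma minimal_generating_quotient G N X :
    N <| G -> minimal_generating G X ->
  exists Y, [/\ Y \subset X, N <*> Y = G & #|Y| <= max_grank (G / N)].
Proof.
move=> nsNG /minimal_generatingP[genX _].
have nNG := normal_norm nsNG.
have sXG : X \subset G by rewrite -genX subset_gen.
have : N <*> X == G by rewrite -joing_idr genX; apply/eqP/joing_idPr/normal_sub.
case/(@minset_exists _ (fun Y => N <*> Y == G)) => Y /minsetP[/eqP NY minY] sYX.
have sYG : Y \subset G := subset_trans sYX sXG.
(* Minimality of [Y] forces the lift of [B] to be all of [Y]. The case [B = Y / N] shows that [Y]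
   loses no elements modulo [N]; arbitrary [B] gives minimality of [Y / N]. *)
have lift (B : {set coset_of N}) :
    B \subset Y / N -> <<B>> = G / N -> #|Y| <= #|B| /\ Y / N = B.
  move=> sBY genB.
  have [Z [sZY ZB leZB]] := quotient_subset_lift (subset_trans sYG nNG) sBY.
  suff <- : Z = Y by [].
  apply: minY => //; rewrite -gen_quotient_eq ?(subset_trans sZY) //.
  by rewrite ZB genB.
have genYN : <<Y / N>> = G / N by apply/eqP; rewrite gen_quotient_eq // NY.
exists Y; split=> //; apply: (@leq_trans #|Y / N|).
  by have [] := lift _ (subxx _) genYN.
apply: (@leq_bigmax_cond _ (minimal_generating (G / N)) (fun B => #|B|)).
apply/minsetP; rewrite genYN; split=> // B /eqP genB sBY.
by have [_ ->] := lift B sBY genB.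
Qed.

(** [H] normalises [N :&: H], and the abelian group [N] centralises it, so [G = N * H] normalises
    it; minimality of [N] leaves only [1] or [N]. *)
Lemma minnormal_abelian_setI G N H :
    minnormal N G -> abelian N -> N * H = G -> ~~ (N \subset H) -> N :&: H = 1.
Proof.
move=> /mingroupP[/andP[_ nNG] minN] abN defG; apply: contraNeq => ntNH.
apply/setIidPl; apply: (minN (N :&: H)%G); rewrite ?subsetIl // ntNH -defG /=.
rewrite mulG_subG; apply/andP; split.
  by rewrite cents_norm // centsC (subset_trans (subsetIl _ _)).
have sHG : H \subset G by rewrite -defG mulG_subr.
by rewrite normsI ?normG // (subset_trans sHG).
Qed.

Lemma max_grank_minnormal G N :
    N \subset G -> minnormal N G -> abelian N ->
  max_grank G <= max_grank (G / N) + [splits G, over N].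
Proof.
move=> sNG minN abN; have /mingroupP[/andP[ntN nNG] _] := minN.
have nsNG : N <| G by apply/andP.
apply/bigmax_leqP => X minX; have /minimal_generatingP[genX _] := minX.
have [Y [sYX NY leY]] := minimal_generating_quotient nsNG minX.
have sXG : X \subset G by rewrite -genX subset_gen.
have nNK (Z : {set gT}) : Z \subset X -> <<Z>> \subset 'N(N).
  by move=> sZX; rewrite gen_subG (subset_trans sZX) // (subset_trans sXG).
have mulNK (Z : {set gT}) : Y \subset Z -> Z \subset X -> N * <<Z>> = G.
  move=> sYZ sZX; rewrite -norm_joinEr ?nNK // joing_idr.
  apply/eqP; rewrite eqEsubset join_subG sNG (subset_trans sZX) //=.
  by rewrite -{1}NY genS ?setUS.
have full (Z : {set gT}) : Y \subset Z -> Z \subset X -> N \subset <<Z>> -> Z = X.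
  move=> sYZ sZX sNZ; apply: (minimal_generating_sub minX) => //.
  by rewrite -(mulNK Z) // mulSGid.
have [sNY | not_sNY] := boolP (N \subset <<Y>>).
  by rewrite -(full Y) // (leq_trans leY) ?leq_addr.
have triv (Z : {set gT}) :
    Y \subset Z -> Z \subset X -> ~~ (N \subset <<Z>>) -> N :&: <<Z>> = 1.
  move=> sYZ sZX; apply: (minnormal_abelian_setI minN abN) => /=.
  exact: mulNK.
have tiY := triv Y (subxx _) sYX not_sNY.
have -> : [splits G, over N].
  by apply/splitsP; exists <<Y>>%G; apply/complP; rewrite tiY mulNK.
have [x Xx notYx] : exists2 x, x \in X & x \notin Y.
  apply/subsetPn; apply: contra not_sNY => sXY.
  by rewrite (subset_trans sNG) // -genX genS.
have sYxX : x |: Y \subset X by rewrite subUset sub1set Xx.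
have sYYx : Y \subset x |: Y by rewrite subsetUr.
suff sNYx : N \subset <<x |: Y>>.
  by rewrite -(full (x |: Y)) // cardsU1 notYx addnC leq_add.
(* Otherwise [<<Y>>] and [<<x |: Y>>] are both complements of [N], hence have the same order and
   coincide. Then [x] lies in [<<Y>>] and is redundant in [X]. *)
apply/negPn/negP => not_sNYx.
have tiYx := triv _ sYYx sYxX not_sNYx.
have cardK (Z : {set gT}) :
    N :&: <<Z>> = 1 -> N * <<Z>> = G -> (#|N| * #|<<Z>>|)%N = #|G|.
  by move=> /TI_cardMg <- ->.
have eqYx : <<Y>> = <<x |: Y>>.
  apply/eqP; rewrite eqEcard genS //= -(leq_pmul2l (cardG_gt0 N)).
  by rewrite !cardK ?mulNK.
have sYDx : Y \subset X :\ x by rewrite subsetD1 sYX.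
suff /setP/(_ x) : X :\ x = X by rewrite !inE eqxx Xx.
apply: (minimal_generating_sub minX); rewrite ?subsetDl // -genX.
apply/eqP; rewrite eqEsubset genS ?subsetDl //= gen_subG.
apply/subsetP => y Xy; have [-> | neq_yx] := eqVneq y x.
  by apply: (subsetP (genS sYDx)); rewrite eqYx mem_gen ?setU11.
by rewrite mem_gen // !inE neq_yx.
Qed.

End MinimalGeneratingSets.

Section SylowRanks.

Variable gT : finGroupType.
Implicit Types (G H N P : {group gT}) (p : nat).

Lemma sylow_grank_quotient_le p G N :
  N <| G -> sylow_grank p (G / N) <= sylow_grank p G.
Proof.
move=> nsNG; have [P sylP] := Sylow_exists p G.
have nNP : P \subset 'N(N).
  by rewrite (subset_trans (pHall_sub sylP)) ?normal_norm.
rewrite (sylow_grankE sylP) (sylow_grankE (quotient_pHall nNP sylP)).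
exact: quotient_grank.
Qed.

(** By Dedekind's law a complement [H] gives [P = N * (H :&: P)]. If [N] were inside ['Phi(P)], then
    [H :&: P] alone would generate [P], putting [N] inside [H]. *)
Lemma sylow_grank_quotient_lt p G N :
    N <| G -> p.-group N -> N :!=: 1 -> [splits G, over N] ->
  sylow_grank p (G / N) < sylow_grank p G.
Proof.
move=> nsNG pN ntN /splitsP[H /complP[tiNH defG]].
have [P sylP] := Sylow_exists p G; have sPG := pHall_sub sylP.
have sNP : N \subset P.
  by rewrite (subset_trans _ (pcore_sub_Hall sylP)) ?pcore_max.
have nNP : P \subset 'N(N) by rewrite (subset_trans sPG) ?normal_norm.
rewrite (sylow_grankE sylP) (sylow_grankE (quotient_pHall nNP sylP)).
apply: (grank_pgroup_quotient_lt (pHall_pgroup sylP)); first exact/andP.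
apply: contra ntN => sNPhi.
have defP : N * (H :&: P) = P by rewrite group_modl // defG; apply/setIidPr.
have : <<H :&: P>> = P.
  apply: Phi_nongen; apply/eqP.
  rewrite eqEsubset join_subG Phi_sub subsetIr -{1}defP /=.
  by rewrite mulG_subG joing_subr (subset_trans sNPhi) ?joing_subl.
rewrite genGid => defHP; rewrite -subG1 -tiNH subsetI subxx.
by rewrite (subset_trans sNP) // -defHP subsetIl.
Qed.

(** Primes of [#|G|] not dividing [#|G / N|] contribute zero, their Sylow subgroups in [G / N] being
    trivial. Both deltas thus become sums over the same primes. *)
Lemma delta_quotient G N :
  N <| G -> delta (G / N) = \sum_(p <- primes #|G|) sylow_grank p (G / N).
Proof.
move=> nsNG.
have dvdGN : #|G / N| %| #|G| by rewrite dvdn_quotient.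
have eqGN :
    perm_eq (primes #|G / N|) [seq p <- primes #|G| | p \in primes #|G / N|].
  apply: uniq_perm; rewrite ?filter_uniq ?primes_uniq // => p.
  rewrite mem_filter andb_idr // !mem_primes => /and3P[-> _ p_dvd].
  by rewrite cardG_gt0 (dvdn_trans p_dvd).
rewrite /delta (perm_big _ eqGN) big_filter big_mkcond; apply: eq_bigr => p _.
have [// | notp] := ifPn.
have sylP : p.-Sylow(G / N) 1.
  rewrite pHallE sub1G cards1 p_part /=.
  by move: notp; rewrite -logn_gt0 -eqn0Ngt => /eqP->.
rewrite (sylow_grankE sylP); apply/esym/eqP; rewrite -leqn0.
by have:= grank_min (set0 : {set coset_of N}); rewrite gen0 cards0.
Qed.

Lemma delta_minnormal G N :
    N <| G -> N :!=: 1 -> is_abelem N ->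
  delta (G / N) + [splits G, over N] <= delta G.
Proof.
move=> nsNG ntN /is_abelemP[p p_pr abN]; rewrite delta_quotient // /delta.
have pN := abelem_pgroup abN.
have Gp : p \in primes #|G|.
  have [_ p_dvd _] := pgroup_pdiv pN ntN.
  by rewrite mem_primes p_pr cardG_gt0 (dvdn_trans p_dvd) ?cardSg ?normal_sub.
(* Only the term at the prime [p] of [N] has to absorb the extra 1 of the split case. *)
rewrite !(bigD1_seq p) ?primes_uniq //= addnAC leq_add //.
  case: (boolP [splits G, over N]) => [splitG | _].
    by rewrite addn1 sylow_grank_quotient_lt.
  by rewrite addn0 sylow_grank_quotient_le.
by apply: leq_sum => q _; apply: sylow_grank_quotient_le.
Qed.

End SylowRanks.

Theorem theorem1p1 (gT : finGroupType) (G : {group gT}) :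
  solvable G -> max_grank G <= delta G.
Proof.
(* The type [gT] is generalised too, because [G / N] lives in the coset type. *)
have [n] := ubnP #|G|; elim: n => // n IHn in gT G * => /ltnSE-leGn solG.
have [G1 | ntG] := eqVneq (G : {set gT}) 1.
  apply/bigmax_leqP => X minX.
  rewrite -(minimal_generating_sub minX (sub0set X)) ?cards0 //.
  by rewrite gen0 G1.
have [N minN sNG] := minnormal_exists ntG (normG G).
have [nNG ntN abN] := minnormal_solvable minN sNG solG.
have nsNG : N <| G by apply/andP.
apply: leq_trans (max_grank_minnormal sNG minN _) _.
  by have /is_abelemP[p _ /abelem_abelian] := abN.
apply: leq_trans (delta_minnormal nsNG ntN abN); rewrite leq_add2r.
by rewrite IHn ?quotient_sol // (leq_trans (ltn_quotient ntN sNG)).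
Qed.
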